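(* Let $A$ be a $C^*$-algebra and $E$ a Hilbert $A$-module. Let $(T_n)_{n}$ be a sequence of adjointable operators on $E$ converging $*$-strongly to $T\in\mathcal L_A(E)$. Then for any compact operator $K\in\mathcal K_A(E)$, we have norm-convergence $KT_n\to KT$ and $T_nK\to TK$.
   Context: $\mathcal L_A(E)$ denotes the adjointable operators on $E$ and $\mathcal K_A(E)$ the compact operators, i.e. the norm closure of the span of the rank-one operators $\theta_{\psi,\eta}\xi=\psi\langle\eta|\xi\rangle$. $*$-strong convergence $T_n\to T$ means that $T_n\psi\to T\psi$ and $T_n^*\psi\to T^*\psi$ in norm for every $\psi\in E$. *)

(* Defs.v *)
From HB Require Import structures.
From mathcomp Require Import all_boot all_order all_algebra.
From mathcomp Require Import complex.
From mathcomp Require Import all_classical all_reals all_analysis.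

Set Implicit Arguments.
Unset Strict Implicit.
Unset Printing Implicit Defensive.

Import Order.TTheory GRing.Theory Num.Theory.
Import numFieldNormedType.Exports.

Local Open Scope classical_set_scope.
Local Open Scope ring_scope.
Local Open Scope complex_scope.

(* The algebra is not assumed unital, so its product cannot come from the
   (unital) ring structures of MathComp. *)
HB.mixin Record CompleteNormedModule_isCStar (R : realType) A
    of CompleteNormedModule R[i] A := {
  cmul : A -> A -> A;
  cstar : A -> A;
  cmulA : forall a b c, cmul a (cmul b c) = cmul (cmul a b) c;
  cmulDl : forall a b c, cmul (a + b) c = cmul a c + cmul b c;
  cmulDr : forall a b c, cmul a (b + c) = cmul a b + cmul a c;
  cmulZl : forall (z : R[i]) a b, cmul (z *: a) b = z *: cmul a b;
  cmulZr : forall (z : R[i]) a b, cmul a (z *: b) = z *: cmul a b;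
  cstarK : forall a, cstar (cstar a) = a;
  cstarD : forall a b, cstar (a + b) = cstar a + cstar b;
  cstarZ : forall (z : R[i]) a, cstar (z *: a) = z^* *: cstar a;
  cstarM : forall a b, cstar (cmul a b) = cmul (cstar b) (cstar a);
  cnormM : forall a b, `|cmul a b| <= `|a| * `|b|;
  cnorm_star : forall a, `|cmul (cstar a) a| = `|a| ^+ 2
}.

#[short(type="cstarAlgType")]
HB.structure Definition CStarAlgebra (R : realType) :=
  { A of CompleteNormedModule R[i] A & CompleteNormedModule_isCStar R A }.

Definition cpos (R : realType) (A : cstarAlgType R) (a : A) : Prop :=
  exists b : A, a = cmul (cstar b) b.

(* Right Hilbert A-modules; the inner product is A-linear in its second
   variable. By [hnormE] the norm of the underlying complete normed space is
   the one induced by the inner product, hence definiteness of the inner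
   product and completeness of E are part of the structure. *)
HB.mixin Record CompleteNormedModule_isHilbert
    (R : realType) (A : cstarAlgType R) E of CompleteNormedModule R[i] E := {
  hact : E -> A -> E;
  hinner : E -> E -> A;
  hactA : forall x a b, hact (hact x a) b = hact x (cmul a b);
  hactDl : forall x y a, hact (x + y) a = hact x a + hact y a;
  hactDr : forall x a b, hact x (a + b) = hact x a + hact x b;
  hactZl : forall (z : R[i]) x a, hact (z *: x) a = z *: hact x a;
  hactZr : forall (z : R[i]) x a, hact x (z *: a) = z *: hact x a;
  hinnerDr : forall x y y', hinner x (y + y') = hinner x y + hinner x y';
  hinnerZr : forall (z : R[i]) x y, hinner x (z *: y) = z *: hinner x y;
  hinner_act : forall x y a, hinner x (hact y a) = cmul (hinner x y) a;
  hinner_star : forall x y, cstar (hinner x y) = hinner y x;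
  hinner_pos : forall x, cpos (hinner x x);
  hnormE : forall x : E, `|x| ^+ 2 = `|hinner x x|
}.

#[short(type="hilbertModType")]
HB.structure Definition HilbertModule (R : realType) (A : cstarAlgType R) :=
  { E of CompleteNormedModule R[i] E & CompleteNormedModule_isHilbert R A E }.

Section Operators.
Context (R : realType) (A : cstarAlgType R) (E : hilbertModType A).
Implicit Types (T S K : E -> E).

Definition is_adjoint T S : Prop :=
  forall x y : E, hinner (T x) y = hinner x (S y) :> A.

(* Complex linearity, A-linearity and boundedness follow from the existence of
   an adjoint. *)
Definition adjointable : set (E -> E) := [set T | exists S, is_adjoint T S].

(* The adjoint is unique when it exists, so [xget] returns it. *)
Definition adjoint T : E -> E := xget (fun=> 0) [set S | is_adjoint T S].

(* MathComp-Analysis norms over R[i] take (nonnegative real) values in R[i],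
   so the real part loses nothing. *)
Definition opnorm T : \bar R :=
  ereal_sup [set (complex.Re `|T x|)%:E | x in [set x : E | `|x| <= 1]].

Definition opnorm_cvg (S_ : nat -> E -> E) S : Prop :=
  (fun n => opnorm (S_ n \- S)) @ \oo --> 0%E.

Definition star_strong_cvg (T_ : nat -> E -> E) T : Prop :=
  forall psi : E, (fun n => T_ n psi) @ \oo --> T psi /\
                  (fun n => adjoint (T_ n) psi) @ \oo --> adjoint T psi.

Definition rank_one (psi eta : E) : E -> E :=
  fun xi => hact psi (hinner eta xi : A).

Definition finite_rank : set (E -> E) :=
  [set F | exists (m : nat) (c : 'I_m -> R[i]) (psi eta : 'I_m -> E),
     F = fun xi => \sum_(i < m) c i *: rank_one (psi i) (eta i) xi].

(* The norm closure of the span of the rank-one operators in the space of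
   adjointable operators. *)
Definition compact_op : set (E -> E) :=
  [set K | adjointable K /\
     forall e : R, 0 < e ->
       exists2 F, finite_rank F & (opnorm (K \- F)%R < e%:E)%E].

End Operators.

(* Main.v *)
(* Put D_n = T_n - T, with adjoint V_n. By uniform boundedness |D_n| <= M for
   all n. A compact K is within e of a finite-rank F = sum_i c_i psi_i <eta_i, ->,
   so K D_n and D_n K are within M e of F D_n = sum_i c_i psi_i <V_n eta_i, -> and
   D_n F = sum_i c_i (D_n psi_i) <eta_i, ->, whose norms tend to 0 because
   V_n eta_i -> 0 and D_n psi_i -> 0. *)
Require Import Defs.
From mathcomp Require Import all_boot all_order all_algebra.
From mathcomp Require Import all_classical all_reals all_analysis.
From mathcomp Require Import complex ring lra.

Set Implicit Arguments.
Unset Strict Implicit.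
Unset Printing Implicit Defensive.

Import Order.TTheory GRing.Theory Num.Theory.
Import numFieldNormedType.Exports.

Local Open Scope classical_set_scope.
Local Open Scope ring_scope.
Local Open Scope complex_scope.

(* Norms over R[i] take values in R[i]; inequalities are easier in R. *)
Definition rnorm (R : realType) (V : normedModType R[i]) (x : V) : R :=
  complex.Re `|x|.

(** * Real-valued norms on complex normed spaces *)

Section RealNorm.
Context (R : realType) (V : normedModType R[i]).
Implicit Types x y : V.

Lemma complex_ge0E (z : R[i]) : 0 <= z -> z = (complex.Re z)%:C.
Proof. by case: z => a b; rewrite lecE /= => /andP[/eqP -> _]. Qed.

Lemma rnormE x : `|x| = (rnorm x)%:C.
Proof. exact: complex_ge0E. Qed.

Lemma rnorm_ge0 x : 0 <= rnorm x.
Proof. by have := normr_ge0 x; rewrite rnormE lecR. Qed.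

Lemma rnormD x y : rnorm (x + y) <= rnorm x + rnorm y.
Proof. by have := ler_normD x y; rewrite !rnormE -rmorphD lecR. Qed.

Lemma rnormN x : rnorm (- x) = rnorm x.
Proof. by rewrite /rnorm normrN. Qed.

Lemma rnormB x y : rnorm (x - y) <= rnorm x + rnorm y.
Proof. by rewrite -(rnormN y) rnormD. Qed.

Lemma rnormZ (z : R[i]) x : rnorm (z *: x) = complex.Re `|z| * rnorm x.
Proof.
by rewrite /rnorm normrZ rnormE (complex_ge0E (normr_ge0 z)) -rmorphM.
Qed.

Lemma rnormZr (r : R) x : rnorm (r%:C *: x) = `|r| * rnorm x.
Proof. by rewrite rnormZ normc_def /= expr0n /= addr0 sqrtr_sqr. Qed.

Lemma rnorm_scalei x : rnorm ('i *: x) = rnorm x.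
Proof. by rewrite rnormZ normCi mul1r. Qed.

Lemma rnorm0 : rnorm (0 : V) = 0.
Proof. by rewrite /rnorm normr0. Qed.

Lemma rnorm_eq0 x : rnorm x = 0 -> x = 0.
Proof. by move=> x0; apply/eqP; rewrite -normr_eq0 rnormE x0. Qed.

Lemma rnorm_normalize x : rnorm ((rnorm x)^-1%:C *: x) <= 1.
Proof.
rewrite rnormZr ger0_norm ?invr_ge0 ?rnorm_ge0 //.
by have [->|x0] := eqVneq (rnorm x) 0; rewrite ?mulr0 ?mulVf.
Qed.

Lemma rnorm_sum (m : nat) (F : 'I_m -> V) :
  rnorm (\sum_i F i) <= \sum_i rnorm (F i).
Proof.
elim/big_ind2 : _ => [|x a y b xa yb|//]; first by rewrite rnorm0.
by rewrite (le_trans (rnormD _ _)) ?lerD.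
Qed.

Lemma cvg_rnorm (u : nat -> V) (l : V) :
  u @ \oo --> l -> (fun n => rnorm (u n - l)) @ \oo --> (0 : R).
Proof.
move=> /cvgrPdist_lt ul; apply/cvgrPdist_lt => e e0.
have := ul e%:C; rewrite ltcR => /(_ e0); apply: filterS => n.
by rewrite rnormE ltcR sub0r normrN ger0_norm ?rnorm_ge0 // -rnormN opprB.
Qed.

End RealNorm.

(** * Nested balls and uniform boundedness *)

Section UniformBoundedness.
Context (R : realType) (V : completeNormedModType R[i]).

(** All centres from index [m] on lie within [r m] of [x m], so they form a Cauchy sequence, and
    closed balls retain its limit. *)
Lemma nested_ball_point (x : nat -> V) (r : nat -> R) :
  (forall n, 0 < r n) -> (r @ \oo --> (0 : R)) ->
  (forall m n, (m <= n)%N -> rnorm (x n - x m) <= r m) ->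
  exists l, forall n, rnorm (l - x n) <= r n.
Proof.
move=> r0 rcv xr.
have /cauchy_cvgP xl : cauchy (x @ \oo).
  apply: cauchy_exP => e e0.
  have eE := complex_ge0E (ltW e0).
  have e'0 : 0 < complex.Re e by rewrite eE ltcR in e0.
  have /cvgrPdist_lt/(_ _ e'0) [N _ rN] := rcv.
  exists (x N); exists N => // n /= Nn.
  rewrite -ball_normE /ball_ /= eE rnormE ltcR -rnormN opprB.
  rewrite (le_lt_trans (xr _ _ Nn)) //.
  by have := rN N (leqnn N); rewrite sub0r normrN gtr0_norm.
exists (lim (x @ \oo)) => m.
apply/ler_addgt0Pr => e e0.
have /cvg_rnorm/cvgrPdist_lt/(_ _ e0) [N _ xN] := xl.
have := xN (maxn N m) (leq_maxl _ _).
have := xr m (maxn N m) (leq_maxr _ _).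
rewrite sub0r normrN ger0_norm ?rnorm_ge0 //.
set y := x (maxn N m); set l := lim _ => h1 h2.
have -> : l - x m = (y - x m) - (y - l) by rewrite opprB [RHS]addrC addrA subrK.
by rewrite (le_trans (rnormB _ _)) // lerD // ltW.
Qed.

(* The library's [Banach_Steinhauss] only covers a [realType] of scalars, and
   R[i] is not one. *)
Lemma uniform_boundedness (I : Type) (p : I -> V -> R) (c : I -> R) :
  (forall i x y, p i (x + y) <= p i x + p i y) ->
  (forall i (r : R) x, p i (r%:C *: x) = `|r| * p i x) ->
  (forall i x, p i x <= c i * rnorm x) ->
  (forall x, exists M, forall i, p i x <= M) ->
  exists M, forall i x, p i x <= M * rnorm x.
Proof.
move=> pD pZ pc pM.
have pN i x : p i (- x) = p i x.
  by rewrite -scaleN1r -(rmorphN1 (real_complex R)) pZ normrN1 mul1r.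
have p0 i : p i 0 = 0 by rewrite -(scale0r 0) pZ normr0 mul0r.
have p_ge0 i x : 0 <= p i x.
  by have := pD i x (- x); rewrite subrr p0 pN; lra.
(* Either one constant bounds the family on some closed ball, or it is unbounded on every ball; the
   second case contradicts pointwise boundedness. *)
have [[x0 [r [M [r0 bM]]]]|nb] := pselect (exists x0 r M, 0 < r /\
    forall i x, rnorm (x - x0) <= r -> p i x <= M).
  (* Rescaling [x] to norm [r] and writing it as a difference of two points of the ball gives the
     value [2 * M]. *)
  exists (2 * M / r) => i x.
  have [/rnorm_eq0 ->|xn0] := eqVneq (rnorm x) 0.
    by rewrite p0 rnorm0 mulr0.
  have x_gt0 : 0 < rnorm x by rewrite lt_def xn0 rnorm_ge0.
  have t0 : 0 < r / rnorm x by rewrite divr_gt0.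
  have h1 : p i (x0 + (r / rnorm x)%:C *: x) <= M.
    by apply: bM; rewrite addrC addKr rnormZr gtr0_norm // divfK.
  have h2 : p i x0 <= M by apply: bM; rewrite subrr rnorm0 ltW.
  have := pD i (x0 + (r / rnorm x)%:C *: x) (- x0).
  rewrite addrC addKr pN pZ gtr0_norm // => h3.
  have h4 : r / rnorm x * p i x <= 2 * M by lra.
  rewrite -(ler_pM2l t0) (le_trans h4) //.
  by rewrite le_eqVlt; apply/orP; left; apply/eqP; field; rewrite xn0 gt_eqF.
(* Inside any ball there is a ball of at most half the radius on which, at each point, some [p i]
   exceeds [n]. Positivity of the radius is a premise, so that a choice function exists on all
   triples; [(0, 0)] is the default. *)
have step (s : V * R * nat) : exists t : V * R, 0 < s.1.2 ->
    [/\ 0 < t.2, t.2 <= s.1.2 / 2,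
        forall y, rnorm (y - t.1) <= t.2 -> rnorm (y - s.1.1) <= s.1.2 &
        forall y, rnorm (y - t.1) <= t.2 -> exists i, s.2%:R < p i y].
  case: s => -[x0 r] n /=.
  have [r0|] := ltP 0 r; last by exists (0, 0); lra.
  have [i [x [xr px]]] : exists i x, rnorm (x - x0) <= r / 2 /\ n%:R < p i x.
    apply: contrapT => H; apply: nb; exists x0, (r / 2), n%:R.
    split=> [|i x xr]; first by lra.
    by rewrite leNgt; apply/negP => px; apply: H; exists i, x.
  (* The sign of [c i] is unknown. With this Lipschitz constant, the radius below lets [p i] drop by
     at most half of its excess over [n]. *)
  have c1 : 0 < `|c i| + 1 by rewrite ltr_wpDl.
  have d0 : 0 < (p i x - n%:R) / 2 / (`|c i| + 1).
    by rewrite !divr_gt0 // subr_gt0.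
  exists (x, Num.min (r / 2) ((p i x - n%:R) / 2 / (`|c i| + 1))) => _ /=.
  split.
  - by rewrite lt_min d0 andbT; lra.
  - by rewrite ge_min lexx.
  - move=> y; rewrite le_min => /andP[yr _].
    have -> : y - x0 = (y - x) + (x - x0) by rewrite addrA subrK.
    by rewrite (le_trans (rnormD _ _)) //; lra.
  - move=> y; rewrite le_min => /andP[_ yd]; exists i.
    have h1 := pD i y (- (y - x)).
    rewrite opprB addrC subrK -(opprB y) pN in h1.
    have h2 := pc i (y - x).
    have h3 : c i * rnorm (y - x) <= (`|c i| + 1) * rnorm (y - x).
      by rewrite ler_wpM2r ?rnorm_ge0 // (le_trans (ler_norm _)) // lerDl.
    rewrite ler_pdivlMr // mulrC in yd.
    lra.
have [f fP] := choice step.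
pose s := fix s n : V * R := if n is m.+1 then f (s m, m) else (0, 1).
have s0 n : 0 < (s n).2.
  by elim: n => [|n IH] /=; [exact: ltr01|case: (fP (s n, n) IH)].
have sP n := fP (s n, n) (s0 n).
have sub m n y : (m <= n)%N -> rnorm (y - (s n).1) <= (s n).2 ->
    rnorm (y - (s m).1) <= (s m).2.
  move=> /subnKC <-; elim: (n - m)%N y => [|k IH] y; first by rewrite addn0.
  by rewrite addnS => h; apply: IH; case: (sP (m + k)%N) => _ _ + _; apply.
have rgeo n : (s n).2 <= geometric 1 (2^-1) n.
  elim: n => [|n IH]; first by rewrite /geometric /= expr0 mulr1.
  have [_ h _ _] := sP n.
  have -> : geometric 1 (2^-1) n.+1 = geometric 1 (2^-1) n / 2 :> R.
    by rewrite /geometric /= exprSr mulrA.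
  by rewrite /= in h IH *; lra.
have rcv : (fun n => (s n).2) @ \oo --> (0 : R).
  apply: (@squeeze_cvgr _ _ _ _ (cst 0) (geometric 1 (2^-1))).
  - by apply: nearW => n; rewrite /= ltW //=.
  - exact: cvg_cst.
  - by apply: cvg_geometric; rewrite ger0_norm; lra.
have [|l lP] := @nested_ball_point (fun n => (s n).1) _ s0 rcv.
  by move=> m n mn; apply: (sub m n) => //; rewrite subrr rnorm0 ltW.
have [M lM] := pM l.
(* [N] exceeds [M], and the ball of index [N.+1], which contains [l], was chosen so that some [p i]
   exceeds [N] at each of its points. *)
set N := (Num.truncn M).+1.
have [_ _ _ /(_ l (lP N.+1)) [i Ni]] := sP N.
by have := lt_le_trans Ni (lM i); rewrite ltNge ltW // truncnS_gt.
Qed.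

End UniformBoundedness.

Lemma conj_real_complex (R : realType) (r : R) : Num.conj (r%:C) = r%:C.
Proof. by apply: conj_Creal; rewrite complex_real. Qed.

(** * Norm estimates for the inner product *)

Section HilbertModule.
Context (R : realType) (A : cstarAlgType R) (E : hilbertModType A).
Implicit Types (x y z u v : E) (a b : A).

Lemma cstarN a : cstar (- a) = - cstar a.
Proof. by rewrite -scaleN1r cstarZ rmorphN1 scaleN1r. Qed.

Lemma hinnerDl x x' y : hinner (x + x') y = hinner x y + hinner x' y :> A.
Proof. by rewrite -hinner_star hinnerDr cstarD !hinner_star. Qed.

Lemma hinnerZl (c : R[i]) x y : hinner (c *: x) y = Num.conj c *: hinner x y :> A.
Proof. by rewrite -hinner_star hinnerZr cstarZ hinner_star. Qed.

Lemma hinner_actl x y a : hinner (hact x a) y = cmul (cstar a) (hinner x y).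
Proof. by rewrite -hinner_star hinner_act cstarM hinner_star. Qed.

Lemma hinnerNr x y : hinner x (- y) = - hinner x y :> A.
Proof. by rewrite -scaleN1r hinnerZr scaleN1r. Qed.

Lemma hinnerNl x y : hinner (- x) y = - hinner x y :> A.
Proof. by rewrite -hinner_star hinnerNr cstarN hinner_star. Qed.

Lemma hinner0l y : hinner 0 y = 0 :> A.
Proof. by rewrite -(scale0r 0) hinnerZl rmorph0 scale0r. Qed.

Lemma hinner0r y : hinner y 0 = 0 :> A.
Proof. by rewrite -(scale0r 0) hinnerZr scale0r. Qed.

Lemma rnorm_cmul a b : rnorm (cmul a b) <= rnorm a * rnorm b.
Proof. by have := cnormM a b; rewrite !rnormE -rmorphM lecR. Qed.

(** Combine the C*-identity with submultiplicativity and cancel one factor [rnorm a]. *)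
Lemma rnorm_cstar_le a : rnorm a <= rnorm (cstar a).
Proof.
have aa : rnorm a ^+ 2 <= rnorm (cstar a) * rnorm a.
  have := cnorm_star a; rewrite !rnormE -rmorphXn => -[<-].
  exact: rnorm_cmul.
have [a0|a0] := eqVneq (rnorm a) 0; first by rewrite a0 rnorm_ge0.
by move: aa; rewrite expr2 ler_pM2r // lt_def a0 rnorm_ge0.
Qed.

Lemma rnorm_cstar a : rnorm (cstar a) = rnorm a.
Proof.
by apply/le_anti; rewrite rnorm_cstar_le -{2}(cstarK a) rnorm_cstar_le.
Qed.

Lemma rnorm_hinner_self x : rnorm (hinner x x : A) = rnorm x ^+ 2.
Proof. by have := hnormE x; rewrite !rnormE -rmorphXn => -[->]. Qed.

(** The square of the left side is the norm of $a^*\langle x|x\rangle a$. *)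
Lemma rnorm_hact x a : rnorm (hact x a) <= rnorm x * rnorm a.
Proof.
rewrite -ler_sqr ?nnegrE ?mulr_ge0 ?rnorm_ge0 // -rnorm_hinner_self.
rewrite hinner_act hinner_actl (le_trans (rnorm_cmul _ _)) //.
rewrite exprMn expr2 [leRHS]mulrA ler_wpM2r ?rnorm_ge0 //.
rewrite (le_trans (rnorm_cmul _ _)) // rnorm_cstar rnorm_hinner_self.
by rewrite mulrC.
Qed.

Lemma hinner_diag_sub x z :
  hinner (x + z) (x + z) - hinner (x - z) (x - z) =
  (hinner x z + hinner z x) *+ 2 :> A.
Proof.
rewrite !hinnerDr !hinnerDl !hinnerNr !hinnerNl opprK.
rewrite (AC (2*2) ((1*4)*(2*3))) [X in _ - X](AC (2*2) ((1*4)*(2*3))).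
rewrite /= -opprD opprB [LHS]addrC subrKA.
by rewrite [hinner z x + _]addrC mulr2n.
Qed.

(** Use [hinner_diag_sub] for [y] and for ['i *: y]; the factor ['i] makes the two contributions of
    [hinner y x] cancel. *)
Lemma hinner_polar x y : hinner x y *+ 4 =
  (hinner (x + y) (x + y) - hinner (x - y) (x - y)) -
  'i *: (hinner (x + 'i *: y) (x + 'i *: y) -
         hinner (x - 'i *: y) (x - 'i *: y)) :> A.
Proof.
rewrite !hinner_diag_sub hinnerZr hinnerZl -scalerMnr scalerDr !scalerA.
have -> : 'i * 'i = -1 :> R[i] by rewrite -expr2 sqrCi.
have -> : 'i * Num.conj 'i = 1 :> R[i] by rewrite -normCK normCi expr1n.
rewrite scaleN1r scale1r -mulrnBl opprD opprK addrACA subrr addr0.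
by rewrite -mulr2n -mulrnA.
Qed.

(** Each of the four diagonal terms in the polarization has norm at most $(1+1)^2$, and their sum is
    divided by 4. *)
Lemma hinner_bound_unit x y :
  rnorm x <= 1 -> rnorm y <= 1 -> rnorm (hinner x y : A) <= 4.
Proof.
move=> x1 y1.
have diag z : rnorm z <= 1 -> rnorm (hinner (x + z) (x + z) : A) <= 4.
  move=> z1; rewrite rnorm_hinner_self.
  have := rnormD x z; have := rnorm_ge0 (x + z); nra.
have diff z : rnorm z <= 1 ->
    rnorm (hinner (x + z) (x + z) - hinner (x - z) (x - z) : A) <= 8.
  move=> z1; rewrite (le_trans (rnormB _ _)) //.
  have := diag _ z1; have := diag (- z); rewrite rnormN => /(_ z1); lra.
have : rnorm (hinner x y *+ 4 : A) <= 16.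
  rewrite hinner_polar (le_trans (rnormB _ _)) // rnorm_scalei.
  have := diff _ y1; have := diff ('i *: y); rewrite rnorm_scalei => /(_ y1).
  lra.
by rewrite -scaler_nat -(rmorph_nat (real_complex R)) rnormZr ger0_norm //; lra.
Qed.

(* Polarization suffices here; the constant 1 of Cauchy-Schwarz would require
   the order theory of positive elements of A. *)
Lemma hinner_bound x y : rnorm (hinner x y : A) <= 4 * (rnorm x * rnorm y).
Proof.
have [/rnorm_eq0 ->|x0] := eqVneq (rnorm x) 0.
  by rewrite hinner0l !rnorm0 mul0r mulr0.
have [/rnorm_eq0 ->|y0] := eqVneq (rnorm y) 0.
  by rewrite hinner0r !rnorm0 !mulr0.
have x_gt0 : 0 < rnorm x by rewrite lt_def x0 rnorm_ge0.
have y_gt0 : 0 < rnorm y by rewrite lt_def y0 rnorm_ge0.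
have := hinner_bound_unit (rnorm_normalize x) (rnorm_normalize y).
rewrite hinnerZr hinnerZl conj_real_complex !rnormZr !gtr0_norm ?invr_gt0 //.
by rewrite mulrA -invfM ler_pdivrMl ?mulr_gt0 // [rnorm y * _]mulrC
  [_ * 4]mulrC.
Qed.

(** Test against [z = u - v]. *)
Lemma hinner_inj u v :
  (forall z, hinner z u = hinner z v :> A) -> u = v.
Proof.
move=> uv; apply/eqP; rewrite -subr_eq0; apply/eqP/rnorm_eq0/eqP.
by rewrite -sqrf_eq0 -rnorm_hinner_self hinnerDr hinnerNr uv subrr rnorm0.
Qed.

(** * Adjoints, linearity and a uniform bound *)

Lemma is_adjoint_sym (T S : E -> E) :
  is_adjoint (A := A) T S -> is_adjoint (A := A) S T.
Proof. by move=> TS x y; rewrite -hinner_star -TS hinner_star. Qed.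

Lemma adjointP (T : E -> E) : adjointable (A := A) T ->
  is_adjoint (A := A) T (adjoint (A := A) T).
Proof. by move=> [S TS]; apply: (xgetPex (fun=> 0)); exists S. Qed.

Lemma is_adjointB (T S T' S' : E -> E) : is_adjoint (A := A) T S ->
  is_adjoint (A := A) T' S' -> is_adjoint (A := A) (T \- T') (S \- S').
Proof.
by move=> TS TS' x y; rewrite /= hinnerDl hinnerDr hinnerNl hinnerNr TS TS'.
Qed.

Section Adjoint.
Variables T S : E -> E.
Hypothesis TS : is_adjoint (A := A) T S.
Let ST := is_adjoint_sym TS.

(** Here and in the next two lemmas, pairing with [z] moves [T] to [S z], where the second variable
    is linear; [hinner_inj] concludes. *)
Lemma adjoint_add x y : T (x + y) = T x + T y.
Proof. by apply: hinner_inj => z; rewrite hinnerDr -!ST hinnerDr. Qed.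

Lemma adjoint_scale (c : R[i]) x : T (c *: x) = c *: T x.
Proof. by apply: hinner_inj => z; rewrite hinnerZr -!ST hinnerZr. Qed.

Lemma adjoint_act x (a : A) : T (hact x a) = hact (T x) a.
Proof. by apply: hinner_inj => z; rewrite hinner_act -!ST hinner_act. Qed.

Lemma adjoint_zero : T 0 = 0.
Proof. by have := adjoint_scale 0 0; rewrite !scale0r. Qed.

Lemma adjoint_sub x y : T (x - y) = T x - T y.
Proof. by rewrite adjoint_add -scaleN1r adjoint_scale scaleN1r. Qed.

Lemma adjoint_sum (m : nat) (F : 'I_m -> E) : T (\sum_i F i) = \sum_i T (F i).
Proof. exact: (big_morph T adjoint_add adjoint_zero). Qed.

End Adjoint.

(* Uniform boundedness is applied to the functionals <V_n y, -> = <y, D_n ->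
   for |y| <= 1, whose continuity is known beforehand, unlike that of D_n. *)
Lemma adjointable_uniform_bound (D V : nat -> E -> E) :
  (forall n, is_adjoint (A := A) (D n) (V n)) ->
  (forall x, bounded_fun (fun n => rnorm (D n x))) ->
  exists2 M, 0 < M & forall n x, rnorm (D n x) <= M * rnorm x.
Proof.
move=> DV bD.
pose I := (nat * {y : E | rnorm y <= 1})%type.
have [||||M PM] := @uniform_boundedness R E I
    (fun i x => rnorm (hinner (V i.1 (sval i.2)) x : A))
    (fun i => 4 * rnorm (V i.1 (sval i.2))).
- by move=> i x y; rewrite hinnerDr rnormD.
- by move=> i r x; rewrite hinnerZr rnormZr.
- by move=> i x; rewrite -mulrA hinner_bound.
(* [bounded_fun] provides a bound by every number above [M]; [M + 1] is one. The functional at [x]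
   is then read as the norm of $\langle y|D_n x\rangle$. *)
- move=> x; have [M [_ /(_ (M + 1))]] := bD x.
  rewrite ltrDl ltr01 => /(_ isT) bM.
  exists (4 * (M + 1)) => -[n [y y1]] /=.
  rewrite (is_adjoint_sym (DV n)) (le_trans (hinner_bound _ _)) //.
  have := bM n Logic.I; rewrite /= ger0_norm ?rnorm_ge0 //.
  have := rnorm_ge0 (D n x); have := rnorm_ge0 y; nra.
exists (`|M| + 1) => [|n x]; first by rewrite ltr_wpDl.
rewrite (@le_trans _ _ (M * rnorm x)) //; last first.
  by rewrite ler_wpM2r ?rnorm_ge0 // (le_trans (ler_norm _)) // lerDl.
have [->|D0] := eqVneq (rnorm (D n x)) 0.
  have y1 : rnorm (0 : E) <= 1 by rewrite rnorm0.
  by have := PM (n, exist (fun y : E => rnorm y <= 1) 0 y1) x; apply: le_trans; exact: rnorm_ge0.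
have D_gt0 : 0 < rnorm (D n x) by rewrite lt_def D0 rnorm_ge0.
(* With [y] the normalization of [D n x], the norm of $\langle y|D_n x\rangle$ is exactly
   [rnorm (D n x)]. *)
have := PM (n, exist (fun y : E => rnorm y <= 1) _ (rnorm_normalize (D n x))) x.
rewrite /= (is_adjoint_sym (DV n)) hinnerZl conj_real_complex rnormZr.
by rewrite rnorm_hinner_self gtr0_norm ?invr_gt0 // expr2 mulKf.
Qed.

(** * Operator norm and pointwise bounds *)

Lemma opnorm_le (G : E -> E) (e : R) :
  (forall x, rnorm x <= 1 -> rnorm (G x) <= e) ->
  (opnorm (A := A) G <= e%:E)%E.
Proof.
move=> Ge; apply: ge_ereal_sup => _ [x /= x1 <-]; rewrite lee_fin.
by apply: Ge; move: x1; rewrite rnormE lecR.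
Qed.

Lemma opnorm_ge (G : E -> E) x : rnorm x <= 1 ->
  ((rnorm (G x))%:E <= opnorm (A := A) G)%E.
Proof.
by move=> x1; apply: ereal_sup_ubound; exists x => //=; rewrite rnormE lecR.
Qed.

Lemma rnorm_lt_opnorm (G : E -> E) (e : R) :
  (forall (c : R[i]) x, G (c *: x) = c *: G x) ->
  (opnorm (A := A) G < e%:E)%E -> forall x, rnorm (G x) <= e * rnorm x.
Proof.
move=> GZ Ge x.
have [/rnorm_eq0 ->|x0] := eqVneq (rnorm x) 0.
  by rewrite -(scale0r 0) GZ !scale0r rnorm0 mulr0.
have x_gt0 : 0 < rnorm x by rewrite lt_def x0 rnorm_ge0.
have := le_lt_trans (opnorm_ge G (rnorm_normalize x)) Ge; rewrite lte_fin GZ rnormZr.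
by rewrite gtr0_norm ?invr_gt0 // ltr_pdivrMl // mulrC => /ltW.
Qed.

(** Since [opnorm] may be infinite, convergence in the extended reals splits into eventual
    finiteness (from [e = 1]) and convergence of the finite parts. *)
Lemma opnorm_cvgP (G_ : nat -> E -> E) (G : E -> E) :
  (forall e : R, 0 < e -> \forall n \near \oo,
     forall x, rnorm x <= 1 -> rnorm (G_ n x - G x) <= e) ->
  opnorm_cvg (A := A) G_ G.
Proof.
move=> GG.
have near_le (e : R) : 0 < e ->
    \forall n \near \oo, (opnorm (A := A) (G_ n \- G)%R <= e%:E)%E.
  by move=> /GG; apply: filterS => n; exact: opnorm_le.
have ge0 n : (0 <= opnorm (A := A) (G_ n \- G)%R)%E.
  by apply: le_trans (opnorm_ge _ (x := 0) _); rewrite ?lee_fin ?rnorm_ge0 ?rnorm0.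
apply/fine_cvgP; split.
  have := near_le 1 ltr01; apply: filterS => n h.
  by rewrite ge0_fin_numE // (le_lt_trans h) // ltry.
apply/cvgrPdist_le => e e0; have := near_le e e0; apply: filterS => n h.
rewrite sub0r normrN /= ger0_norm ?fine_ge0 //.
by rewrite -lee_fin fineK // ge0_fin_numE // (le_lt_trans h) // ltry.
Qed.

(** * Finite-rank operators *)

(** Supplies the homogeneity that [rnorm_lt_opnorm] requires of [K \- F]. *)
Lemma adjointable_compact_scale (K F : E -> E) :
  adjointable (A := A) K -> finite_rank (A := A) F ->
  forall (c : R[i]) x, (K \- F) (c *: x) = c *: (K \- F) x.
Proof.
move=> [S KS] [m [c' [psi [eta ->]]]] c x /=.
rewrite (adjoint_scale KS) scalerBr scaler_sumr; congr (_ - _).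
apply: eq_bigr => i _.
by rewrite /rank_one hinnerZr hactZr !scalerA mulrC.
Qed.

Lemma finite_rank_bound m (c : 'I_m -> R[i]) (psi eta : 'I_m -> E) x :
  rnorm (\sum_(i < m) c i *: rank_one (A := A) (psi i) (eta i) x) <=
  (\sum_(i < m) 4 * complex.Re `|c i| * (rnorm (psi i) * rnorm (eta i))) *
    rnorm x.
Proof.
rewrite (le_trans (rnorm_sum _)) // mulr_suml; apply: ler_sum => i _.
have c_ge0 : 0 <= complex.Re `|c i|.
  by rewrite -lecR -complex_ge0E // normr_ge0.
rewrite rnormZ [4 * _]mulrC -!mulrA ler_wpM2l //.
rewrite (le_trans (rnorm_hact _ _)) //.
rewrite [leRHS]mulrCA ler_wpM2l ?rnorm_ge0 // hinner_bound //.
Qed.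

(** This is $\theta_{\psi,\eta}D=\theta_{\psi,D^*\eta}$; its companion below is
    $D\theta_{\psi,\eta}=\theta_{D\psi,\eta}$. *)
Lemma finite_rank_comp m (c : 'I_m -> R[i]) (psi eta : 'I_m -> E)
    (D V : E -> E) x : is_adjoint (A := A) D V ->
  \sum_(i < m) c i *: rank_one (A := A) (psi i) (eta i) (D x) =
  \sum_(i < m) c i *: rank_one (A := A) (psi i) (V (eta i)) x.
Proof.
move=> DV; apply: eq_bigr => i _.
by rewrite /rank_one (is_adjoint_sym DV).
Qed.

Lemma comp_finite_rank m (c : 'I_m -> R[i]) (psi eta : 'I_m -> E)
    (D V : E -> E) x : is_adjoint (A := A) D V ->
  D (\sum_(i < m) c i *: rank_one (A := A) (psi i) (eta i) x) =
  \sum_(i < m) c i *: rank_one (A := A) (D (psi i)) (eta i) x.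
Proof.
move=> DV; rewrite (adjoint_sum DV); apply: eq_bigr => i _.
by rewrite (adjoint_scale DV) /rank_one (adjoint_act DV).
Qed.

End HilbertModule.

Lemma cvg_sum0 (R : realType) m (f : 'I_m -> nat -> R) :
  (forall i, f i @ \oo --> (0 : R)) ->
  (fun n => \sum_(i < m) f i n) @ \oo --> (0 : R).
Proof.
elim: m f => [|m IH] f f0; first by
  under eq_fun do rewrite big_ord0; exact: cvg_cst.
under eq_fun do rewrite big_ord_recl.
have := cvgD (f0 ord0) (IH _ (fun i => f0 (lift ord0 i))).
by rewrite addr0; apply.
Qed.

Theorem lemmaA1 (R : realType) (A : cstarAlgType R) (E : hilbertModType A)
    (T_ : nat -> E -> E) (T : E -> E)
    (hTn : forall n, adjointable (T_ n)) (hT : adjointable T)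
    (hcvg : star_strong_cvg T_ T)
    (K : E -> E) (hK : compact_op K) :
  opnorm_cvg (fun n => K \o T_ n) (K \o T) /\
  opnorm_cvg (fun n => T_ n \o K) (T \o K).
Proof.
pose D n := T_ n \- T; pose V n := adjoint (T_ n) \- adjoint T.
have DV n : is_adjoint (D n) (V n) by apply: is_adjointB; exact: adjointP.
have D0 x : (fun n => rnorm (D n x)) @ \oo --> (0 : R).
  exact: cvg_rnorm (hcvg x).1.
have V0 x : (fun n => rnorm (V n x)) @ \oo --> (0 : R).
  exact: cvg_rnorm (hcvg x).2.
have [M M0 DM] : exists2 M, 0 < M & forall n x, rnorm (D n x) <= M * rnorm x.
  apply: adjointable_uniform_bound DV _ => x.
  by apply: cvg_seq_bounded; apply/cvg_ex; exists 0; exact: D0.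
case: hK => -[S KS] Kfin.
(* Composition with [D n] costs a factor [M], so this tolerance leaves an error of [e / 2] on the
   unit ball. *)
have approx (e : R) : 0 < e -> exists m c psi eta,
    forall x, rnorm (K x - \sum_(i < m) c i *: rank_one (psi i) (eta i) x) <=
      e / 2 / M * rnorm x.
  move=> e0; have d0 : 0 < e / 2 / M by rewrite !divr_gt0.
  have [F Ffin KF] := Kfin _ d0.
  have := rnorm_lt_opnorm (adjointable_compact_scale (ex_intro _ S KS) Ffin) KF.
  by case: Ffin => m [c [psi [eta ->]]] KFx; exists m, c, psi, eta.
have fin_small m (c : 'I_m -> R[i]) (f : 'I_m -> nat -> R) (e : R) :
    (forall i, f i @ \oo --> (0 : R)) -> 0 < e -> \forall n \near \oo,
    \sum_(i < m) 4 * complex.Re `|c i| * f i n <= e.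
  move=> f0 e0.
  have /cvgrPdist_le/(_ _ e0) : 
      (fun n => \sum_(i < m) 4 * complex.Re `|c i| * f i n) @ \oo --> (0 : R).
    apply: cvg_sum0 => i; rewrite -[X in _ --> X](mulr0 (4 * complex.Re `|c i|)).
    by apply: cvgMr; exact: f0.
  by apply: filterS => n; rewrite sub0r normrN; apply: le_trans; exact: ler_norm.
have DM1 n x : rnorm x <= 1 -> rnorm (D n x) <= M.
  move=> x1; rewrite (le_trans (DM n x)) // -[leRHS]mulr1.
  by rewrite ler_wpM2l // ltW.
have mul_half (e s : R) x : 0 < e -> s <= e / 2 -> rnorm x <= 1 ->
    s * rnorm x <= e / 2.
  by move=> e0 se x1; have := rnorm_ge0 x; nra.
split; apply: opnorm_cvgP => e e0;
  have [m [c [psi [eta KF]]]] := approx e e0;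
  have e20 : 0 < e / 2 by rewrite divr_gt0.
- have f0 i : (fun n => rnorm (psi i) * rnorm (V n (eta i))) @ \oo --> (0 : R).
    by rewrite -(mulr0 (rnorm (psi i))); apply: cvgMr; exact: V0.
  apply: filterS (fin_small _ c _ _ f0 e20) => n Fn x x1 /=.
  rewrite -(adjoint_sub KS) -[T_ n x - T x]/(D n x).
  have := KF (D n x); set F := \sum_i _ => KFx.
  (* Split $KD_nx$ into $(K-F)D_nx$, controlled by the approximation and [DM1], and $FD_nx$,
     controlled by $V_n\eta_i\to0$. *)
  rewrite -(subrK F (K _)) (le_trans (rnormD _ _)) // [leRHS]splitr lerD //.
    rewrite (le_trans KFx) // -[leRHS](divfK (lt0r_neq0 M0)).
    by rewrite ler_wpM2l ?DM1 // ltW // divr_gt0.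
  rewrite /F (finite_rank_comp _ _ _ _ (DV n)).
  by rewrite (le_trans (finite_rank_bound _ _ _ _)) // mul_half.
- have f0 i : (fun n => rnorm (D n (psi i)) * rnorm (eta i)) @ \oo --> (0 : R).
    by rewrite -(mul0r (rnorm (eta i))); apply: cvgMl; exact: D0.
  apply: filterS (fin_small _ c _ _ f0 e20) => n Fn x x1 /=.
  rewrite -[T_ n (K x) - T (K x)]/(D n (K x)).
  have := KF x; set F := \sum_i _ => KFx.
  (* Here additivity of [D n] gives the splitting $D_n(K-F)x+D_nFx$, and the second term is small
     because $D_n\psi_i\to0$. *)
  rewrite -(subrK F (K _)) (adjoint_add (DV n)).
  rewrite (le_trans (rnormD _ _)) // [leRHS]splitr lerD //.
    rewrite (le_trans (DM n _)) // mulrC -ler_pdivlMr //.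
    rewrite (le_trans KFx) // -[leRHS]mulr1 ler_wpM2l //.
    by rewrite ltW // divr_gt0.
  rewrite /F (comp_finite_rank _ _ _ _ (DV n)).
  by rewrite (le_trans (finite_rank_bound _ _ _ _)) // mul_half.
Qed.
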